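(* Let $c \geq 4$ and let $G_1, G_2, \ldots, G_c$ be directed graphs on a common set of $n$ vertices. If $e(G_i) > \frac{1}{2}n^2$ for every $i \in \{1,\ldots,c\}$, then there exists a rainbow directed triangle and a rainbow transitive triangle.
   Context: A directed graph $G$ consists of a vertex set $V(G)$ and an edge set $E(G)$ of ordered pairs of distinct vertices (no loops, no multiple edges; both $(u,v)$ and $(v,u)$ may be present). $e(G)=|E(G)|$. The edges of $G_i$ are thought of as having color $i$. A rainbow directed triangle is a triple of distinct vertices $u,v,w$ together with pairwise distinct colors $a,b,d$ such that $(u,v)\in E(G_a)$, $(v,w)\in E(G_b)$, $(w,u)\in E(G_d)$. A rainbow transitive triangle is a triple of distinct vertices $u,v,w$ with pairwise distinct colors $a,b,d$ such that $(u,v)\in E(G_a)$, $(v,w)\in E(G_b)$, $(u,w)\in E(G_d)$. *)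

(* Defs.v *)
From mathcomp Require Import all_boot all_order all_algebra.

Set Implicit Arguments.
Unset Strict Implicit.
Unset Printing Implicit Defensive.

Record digraph (V : finType) := Digraph {
  edges : {set V * V};
  edges_loopless : forall v : V, (v, v) \notin edges
}.

Definition num_edges (V : finType) (G : digraph V) : nat := #|edges G|.

(* The family G assigns to each colour i the digraph G i of the edges of
   colour i; one pair of vertices may be an edge in several colours. *)
Definition rainbow_directed_triangle (V C : finType) (G : C -> digraph V) :
    Prop :=
  exists (u v w : V) (a b d : C),
    [/\ u != v, v != w & u != w] /\
    [/\ a != b, b != d & a != d] /\
    [/\ (u, v) \in edges (G a), (v, w) \in edges (G b)
      & (w, u) \in edges (G d)].

Definition rainbow_transitive_triangle (V C : finType) (G : C -> digraph V) :
    Prop :=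
  exists (u v w : V) (a b d : C),
    [/\ u != v, v != w & u != w] /\
    [/\ a != b, b != d & a != d] /\
    [/\ (u, v) \in edges (G a), (v, w) \in edges (G b)
      & (u, w) \in edges (G d)].

(* Main.v *)
Require Import Defs.
From mathcomp Require Import all_boot all_order all_algebra.
From mathcomp Require Import zify lra.
Import GRing.Theory Num.Theory.

(** Write [w u v] for the number of coloured edges, in both directions, between
    [u] and [v]. Without a rainbow triangle the total number of coloured edges
    on a vertex set [S] is at most [c |S|^2 / 2], by induction on [S]: it
    suffices to delete either a vertex of degree at most [c (|S| - 1) + c / 2]
    or two vertices [u], [v] with [w u x + w v x <= 2 c] for all other [x].

    If there is no rainbow transitive triangle, any [u], [v] with at least two
    colours on the edge from [u] to [v] can be deleted, and if there is no such
    pair then all degrees are small.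

    If there is no rainbow directed triangle, [u] and [v] can be deleted when
    there are at least two colours in each direction. Otherwise [w <= c + 1],
    with equality only if all colours go from [u] to [v] and a single one comes
    back; call this a heavy edge. Two heavy out-neighbours (or in-neighbours)
    [x], [y] of a vertex satisfy [w x y <= 2 <= c - 2]. Hence, if [k] is the
    largest heavy out- or in-degree, attained at [v], then a heavy neighbour of
    [v] on that side has degree at most [c (|S| - 1) + 2 k - 2 (k - 1)]. *)

Set Implicit Arguments.
Unset Strict Implicit.
Unset Printing Implicit Defensive.

Lemma sum_mem_card (T : finType) (S A : {set T}) :
  \sum_(x in S) (x \in A : nat) = #|S :&: A|.
Proof.
rewrite -sum1_card [LHS]big_mkcond [RHS]big_mkcond; apply: eq_bigr => x _.
by rewrite inE; case: (x \in S); case: (x \in A).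
Qed.

(** * Rainbow choices from three colour sets *)

Section Rainbow.

Variable C : finType.
Implicit Types A B D : {set C}.

Definition rainbow A B D : bool :=
  [exists i, exists j, exists k,
     [&& i \in A, j \in B, k \in D, i != j, j != k & i != k]].

Lemma rainbowP A B D :
  reflect (exists i j k, [/\ i \in A, j \in B & k \in D] /\
                         [/\ i != j, j != k & i != k])
          (rainbow A B D).
Proof.
apply: (iffP existsP) => [[i /existsP[j /existsP[k]]]|[i [j [k [[iA jB kD] [ij jk ik]]]]]].
  by case/and5P=> iA jB kD ij /andP[jk ik]; exists i, j, k.
by exists i; apply/existsP; exists j; apply/existsP; exists k; apply/and5P; split=> //; apply/andP.
Qed.

Lemma rainbow_rot A B D : rainbow A B D = rainbow B D A.
Proof.
by apply/rainbowP/rainbowP => [[i [j [k [[? ? ?] [? ? ?]]]]]|[j [k [i [[? ? ?] [? ? ?]]]]]];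
  [exists j, k, i | exists i, j, k]; do 2![split=> //]; rewrite eq_sym.
Qed.

Lemma rainbow_swap A B D : rainbow A B D = rainbow B A D.
Proof.
by apply/rainbowP/rainbowP => [[i [j [k [[? ? ?] [? ? ?]]]]]|[j [i [k [[? ? ?] [? ? ?]]]]]];
  [exists j, i, k | exists i, j, k]; do 2![split=> //]; rewrite eq_sym.
Qed.

Lemma rainbow_rev A B D : rainbow A B D = rainbow D B A.
Proof. by rewrite rainbow_swap 2!rainbow_rot. Qed.

(** Greedy choice, smallest set first: each colour picked removes at most one candidate from the
    later sets. *)
Lemma rainbow_card123 A B D :
  0 < #|A| -> 1 < #|B| -> 2 < #|D| -> rainbow A B D.
Proof.
case/card_gt0P=> i iA B2 D3.
have /card_gt0P[j] : 0 < #|B :\ i| by have := cardsD1 i B; lia.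
rewrite !inE => /andP[ji jB].
have /card_gt0P[k] : 0 < #|D :\ i :\ j|.
  by have := cardsD1 i D; have := cardsD1 j (D :\ i); lia.
rewrite !inE => /and3P[kj ki kD].
by apply/rainbowP; exists i, j, k; do 2![split=> //]; rewrite eq_sym.
Qed.

Hypothesis C4 : 3 < #|C|.

(** Otherwise the two sizes sum to at least 5, so one set has at least 3 colours, and the other is
    nonempty because no set exceeds [#|C|]. *)
Lemma rainbow_free_card A B D :
  ~~ rainbow A B D -> 1 < #|D| -> #|A| + #|B| <= #|C|.
Proof.
move=> nr D2; rewrite leqNgt; apply: contra nr => lt.
have [A_le B_le] := (max_card A, max_card B).
have [A3|A2] := ltnP 2 #|A|; [rewrite rainbow_rot | rewrite 2!rainbow_rot rainbow_swap];
  by apply: rainbow_card123; lia.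
Qed.

End Rainbow.

(** * Weights and the deletion induction *)

Section ColouredEdges.

Variables V C : finType.
Implicit Types (f : V -> V -> {set C}) (S : {set V}) (u v x : V).

Definition pair_weight f u v := #|f u v| + #|f v u|.

Definition degree f S v := \sum_(x in S :\ v) pair_weight f v x.

Definition total_weight f S := \sum_(u in S) \sum_(v in S) #|f u v|.

Definition loopless f := forall v, f v v = set0.

(** Doubled to avoid halving [#|C|]. *)
Definition deletable_vertex f S v :=
  (v \in S) && (2 * degree f S v <= 2 * #|C| * #|S :\ v| + #|C|).

Definition deletable_pair f S u v :=
  [&& u \in S, v \in S, u != v &
    [forall (x | x \in S :\ v :\ u),
       pair_weight f u x + pair_weight f v x <= 2 * #|C|]].

Lemma loopless_neq f u v : loopless f -> 0 < #|f u v| -> u != v.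
Proof. by move=> f0; apply: contraTneq => ->; rewrite f0 cards0. Qed.

Lemma total_weightD1 f S v : loopless f -> v \in S ->
  total_weight f S = total_weight f (S :\ v) + degree f S v.
Proof.
move=> f0 vS; rewrite /total_weight (big_setD1 v) //= (big_setD1 v) //= f0 cards0 add0n.
under [in X in _ + X]eq_bigr => u _ do rewrite (big_setD1 v) //=.
by rewrite /degree /pair_weight !big_split /= addnA addnC.
Qed.

(** The deletion bounds are the increments of c s^2 / 2: c (s - 1) + c / 2 for one vertex, and 2 c
    (s - 2) + 2 c for two, the last 2 c paying for the pair itself. *)
Lemma total_weight_le f S : loopless f ->
  (forall S', S' != set0 -> (exists v, deletable_vertex f S' v) \/
                      (exists u v, deletable_pair f S' u v)) ->
  2 * total_weight f S <= #|C| * #|S| ^ 2.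
Proof.
move=> f0 del; have [m le_m] := ubnP #|S|; elim: m S le_m => // m IH S le_m.
have [->|S0] := eqVneq S set0; first by rewrite /total_weight big_set0.
case: (del S S0) => [[v /andP[vS deg_v]]|[u [v /and4P[uS vS uv /forall_inP w_le]]]].
  have cS := cardsD1 v S; rewrite vS in cS.
  have := IH (S :\ v); rewrite (total_weightD1 f0 vS) cS; nia.
have uSv : u \in S :\ v by rewrite !inE uv.
have cS := cardsD1 v S; rewrite vS in cS.
have cSv := cardsD1 u (S :\ v); rewrite uSv in cSv.
rewrite (total_weightD1 f0 vS) (total_weightD1 f0 uSv) cS cSv.
have := IH (S :\ v :\ u).
set T := S :\ v :\ u in w_le cSv *.
have w_uv : pair_weight f v u <= 2 * #|C|.
  by rewrite mul2n -addnn leq_add ?max_card.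
have deg_uv : degree f (S :\ v) u + degree f S v <= 2 * #|C| * #|T| + 2 * #|C|.
  rewrite [degree f S v](big_setD1 u) //= addnCA -big_split /= addnC leq_add //.
  by rewrite mulnC -sum_nat_const leq_sum.
nia.
Qed.

(** * Transitive triangles *)

Section Transitive.

Variable f : V -> V -> {set C}.
Hypotheses (C4 : 3 < #|C|) (f0 : loopless f).
Hypothesis no_rainbow : forall u v x, ~~ rainbow (f u v) (f v x) (f u x).

Lemma transitive_deletable S : S != set0 ->
  (exists v, deletable_vertex f S v) \/ (exists u v, deletable_pair f S u v).
Proof.
move=> /set0Pn[v0 v0S].
have [/existsP[u /existsP[v /and3P[uS vS uv2]]]|] :=
  boolP [exists u, exists v, [&& u \in S, v \in S & 1 < #|f u v|]].
  right; exists u, v; rewrite /deletable_pair uS vS (loopless_neq f0 (ltnW uv2)).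
  apply/forall_inP => x _.
  (* The edge from [u] to [v] closes a transitive triangle with two edges into [x], and with two
     edges out of [x]. *)
  have to_x : #|f v x| + #|f u x| <= #|C|.
    by apply: (rainbow_free_card C4 _ uv2); rewrite -rainbow_rot.
  have from_x : #|f x u| + #|f x v| <= #|C|.
    by apply: (rainbow_free_card C4 _ uv2); rewrite -rainbow_rot rainbow_swap.
  rewrite /pair_weight; lia.
move=> /existsPn light; left; exists v0; rewrite /deletable_vertex v0S andTb.
have le1 u v : u \in S -> v \in S -> #|f u v| <= 1.
  by move=> uS vS; have /existsPn/(_ v) := light u; rewrite uS vS -leqNgt.
have : degree f S v0 <= 2 * #|S :\ v0|.
  rewrite mulnC -sum_nat_const leq_sum // => x /setD1P[_ xS].
  by rewrite (leq_add (le1 _ _ _ _) (le1 _ _ _ _)).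
have := leq_mul C4 (leqnn #|S :\ v0|); lia.
Qed.

End Transitive.

(** * Directed triangles and heavy edges *)

Definition heavy_nbrs f S u :=
  [set x in S | (#|f u x| == #|C|) && (0 < #|f x u|)].

(** The case where the maximum k is an out-degree. Reversing [f] turns [heavy_nbrs] into heavy
    in-neighbours. *)
Lemma heavy_nbr_deletable f S v :
  (forall u x y, ~~ rainbow (f u x) (f x y) (f y u)) ->
  3 < #|C| -> loopless f -> v \in S ->
  {in S &, forall x y, #|f x y| <= 1 \/ #|f y x| <= 1} ->
  {in S, forall x, #|heavy_nbrs f S x| <= #|heavy_nbrs f S v|} ->
  {in S, forall x, #|heavy_nbrs (fun y z => f z y) S x| <= #|heavy_nbrs f S v|} ->
  exists x, deletable_vertex f S x.
Proof.
move=> no_rainbow C4 f0 vS light max_out max_in.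
set N := heavy_nbrs f S in max_out max_in *; set N' := heavy_nbrs _ S in max_in *.
have w_le x y : x \in S -> y \in S ->
    pair_weight f x y <= #|C| + (y \in N x) + (y \in N' x).
  move=> xS yS; have := light x y xS yS.
  have -> : y \in N x = (#|f x y| == #|C|) && (0 < #|f y x|) by rewrite inE yS.
  have -> : y \in N' x = (#|f y x| == #|C|) && (0 < #|f x y|) by rewrite inE yS.
  have : #|f x y| <= #|C| := max_card _; have : #|f y x| <= #|C| := max_card _.
  rewrite /pair_weight; lia.
have twins x y : x \in N v -> y \in N v -> #|f x y| <= 1.
  rewrite !inE => /and3P[_ /eqP vx _] /and3P[_ _ yv].
  rewrite leqNgt; apply: contra (no_rainbow v x y) => xy2.
  by rewrite rainbow_rev; apply: rainbow_card123; rewrite ?vx // ltnW.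
(* If k = 0, no heavy edge meets [v], and [v] itself is deletable. *)
have [N0|[x xN]] := set_0Vmem (N v).
  exists v; rewrite /deletable_vertex vS andTb.
  have N'0 : N' v = set0.
    by apply/eqP; rewrite -cards_eq0 -leqn0 -[0](cards0 V) -N0 max_in.
  have : degree f S v <= #|C| * #|S :\ v|.
    rewrite mulnC -sum_nat_const leq_sum // => x /setD1P[_ xS].
    by have := w_le v x vS xS; rewrite N0 N'0 !in_set0 !addn0.
  lia.
have xS : x \in S by move: xN; rewrite inE => /andP[].
exists x; rewrite /deletable_vertex xS andTb.
have deg_x : degree f S x + 2 * #|(S :\ x) :&: N v|
    <= #|C| * #|S :\ x| + #|(S :\ x) :&: N x| + #|(S :\ x) :&: N' x|.
  rewrite -!sum_mem_card mulnC [_ * #|S :\ x|]mulnC -sum_nat_const big_distrl -!big_split /=.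
  apply: leq_sum => y /setD1P[_ yS].
  have /= := C4; have /= := w_le x y xS yS; case: (boolP (y \in N v)) => [yN|_]; last by lia.
  by have := twins x y xN yN; have := twins y x yN xN; rewrite /pair_weight; lia.
have NvS : (S :\ x) :&: N v = N v :\ x.
  by apply/setP => y; rewrite !inE; case: (y \in S); rewrite ?andbF ?andbT.
(* The excess over [#|C| * #|S :\ x|] is at most 2 k - 2 (k - 1) = 2; doubled, it is 4, hence at
   most [#|C|]. *)
have := cardsD1 x (N v); rewrite xN -NvS.
have := subset_leq_card (subsetIr (S :\ x) (N x)).
have := subset_leq_card (subsetIr (S :\ x) (N' x)).
have := max_out x xS; have := max_in x xS.
lia.
Qed.

Section Directed.

Variable f : V -> V -> {set C}.
Hypotheses (C4 : 3 < #|C|) (f0 : loopless f).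
Hypothesis no_rainbow : forall u v x, ~~ rainbow (f u v) (f v x) (f x u).

Lemma directed_deletable S : S != set0 ->
  (exists v, deletable_vertex f S v) \/ (exists u v, deletable_pair f S u v).
Proof.
move=> /set0Pn[v0 v0S].
have [/existsP[u /existsP[v /and4P[uS vS uv2 vu2]]]|] :=
  boolP [exists u, exists v, [&& u \in S, v \in S, 1 < #|f u v| & 1 < #|f v u|]].
  right; exists u, v; rewrite /deletable_pair uS vS (loopless_neq f0 (ltnW uv2)).
  apply/forall_inP => x _.
  have via_uv : #|f v x| + #|f x u| <= #|C|.
    by apply: (rainbow_free_card C4 _ uv2); rewrite -rainbow_rot.
  have via_vu : #|f u x| + #|f x v| <= #|C|.
    by apply: (rainbow_free_card C4 _ vu2); rewrite -rainbow_rot.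
  rewrite /pair_weight; lia.
move=> /existsPn light; left.
have {}light : {in S &, forall x y, #|f x y| <= 1 \/ #|f y x| <= 1}.
  move=> x y xS yS; have /existsPn/(_ y) := light x; rewrite xS yS /=.
  by rewrite negb_and -!leqNgt => /orP.
(* Reversing all edges keeps directed triangles directed and weights unchanged. *)
pose fr y z := f z y.
have [a aS a_max] := arg_maxnP (fun x => #|heavy_nbrs f S x|) v0S.
have [b bS b_max] := arg_maxnP (fun x => #|heavy_nbrs fr S x|) v0S.
have [le_ba|/ltnW le_ab] := leqP #|heavy_nbrs fr S b| #|heavy_nbrs f S a|.
  apply: (heavy_nbr_deletable no_rainbow C4 f0 aS light a_max) => x xS.
  exact: leq_trans (b_max x xS) le_ba.
have [||x xS|x] := @heavy_nbr_deletable fr S b _ C4 f0 bS _ b_max.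
- by move=> u x y; rewrite rainbow_rev rainbow_rot; apply: no_rainbow.
- by move=> x y xS yS; apply: light.
- exact: leq_trans (a_max x xS) le_ab.
exists x; rewrite /deletable_vertex /degree.
by under eq_bigr => y _ do rewrite /pair_weight addnC.
Qed.

End Directed.

End ColouredEdges.

(** * From digraph families to colour sets *)

Section Digraphs.

Variables (V C : finType) (G : C -> digraph V).

Definition colours u v : {set C} := [set i | (u, v) \in edges (G i)].

Lemma colours_loopless : loopless colours.
Proof. by move=> v; apply/setP => i; rewrite !inE (negPf (edges_loopless _ _)). Qed.

Lemma sum_num_edges : \sum_i num_edges (G i) = total_weight colours setT.
Proof.
rewrite /total_weight pair_big /=.
under [RHS]eq_bigr => p _ do rewrite -sum1_card big_mkcond.
rewrite exchange_big /=; apply: eq_bigr => i _.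
rewrite /num_edges -sum1_card big_mkcond [RHS]big_mkcond /=.
by apply: eq_bigr => -[u v] _; rewrite !inE.
Qed.

(** Supplies the distinct vertices of a triangle, since [rainbow] only separates colours. *)
Lemma colours_neq u v i : i \in colours u v -> u != v.
Proof. by move=> iuv; apply: (loopless_neq colours_loopless); apply/card_gt0P; exists i. Qed.

Lemma rainbow_directed u v x :
  rainbow (colours u v) (colours v x) (colours x u) -> rainbow_directed_triangle G.
Proof.
case/rainbowP=> i [j [k [[iuv jvx kxu] [ij jk ik]]]].
exists u, v, x, i, j, k.
have [uv vx] := (colours_neq iuv, colours_neq jvx).
have ux : u != x by rewrite eq_sym (colours_neq kxu).
by move: iuv jvx kxu; rewrite !inE.
Qed.

Lemma rainbow_transitive u v x :
  rainbow (colours u v) (colours v x) (colours u x) -> rainbow_transitive_triangle G.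
Proof.
case/rainbowP=> i [j [k [[iuv jvx kux] [ij jk ik]]]].
exists u, v, x, i, j, k.
have [[uv vx] ux] := (colours_neq iuv, colours_neq jvx, colours_neq kux).
by move: iuv jvx kux; rewrite !inE.
Qed.

Hypothesis dense : forall i, #|V| ^ 2 < 2 * num_edges (G i).

Lemma exists_undeletable : 0 < #|C| ->
  ~ (forall S, S != set0 -> (exists v, deletable_vertex colours S v) \/
                      (exists u v, deletable_pair colours S u v)).
Proof.
move=> /card_gt0P[i0 _] /(total_weight_le setT colours_loopless).
rewrite -sum_num_edges cardsT big_distrr /= leqNgt => /negP[].
(* The colour [i0] makes the summed inequality strict. *)
rewrite -sum_nat_const (bigD1 i0) //= [X in _ < X](bigD1 i0) //=.
by rewrite -addSn leq_add ?dense // leq_sum // => i _; apply: ltnW.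
Qed.

Lemma exists_rainbow_directed : 3 < #|C| -> rainbow_directed_triangle G.
Proof.
move=> C4; have [/existsP[u /existsP[v /existsP[x]]]|none] :=
  boolP [exists u, exists v, exists x,
           rainbow (colours u v) (colours v x) (colours x u)].
  exact: rainbow_directed.
case: (exists_undeletable (ltnW (ltnW (ltnW C4)))) => S.
apply: directed_deletable C4 colours_loopless _ _ => u v x.
by move/existsPn/(_ u)/existsPn/(_ v)/existsPn/(_ x): none.
Qed.

Lemma exists_rainbow_transitive : 3 < #|C| -> rainbow_transitive_triangle G.
Proof.
move=> C4; have [/existsP[u /existsP[v /existsP[x]]]|none] :=
  boolP [exists u, exists v, exists x,
           rainbow (colours u v) (colours v x) (colours u x)].
  exact: rainbow_transitive.
case: (exists_undeletable (ltnW (ltnW (ltnW C4)))) => S.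
apply: transitive_deletable C4 colours_loopless _ _ => u v x.
by move/existsPn/(_ u)/existsPn/(_ v)/existsPn/(_ x): none.
Qed.

End Digraphs.

Theorem theorem1 (c n : nat) (V : finType) (G : 'I_c -> digraph V)
    (hc : 4 <= c) (hn : #|V| = n)
    (hG : forall i : 'I_c,
        (1 / 2 * n%:R ^+ 2 < (num_edges (G i))%:R :> rat)%R) :
  rainbow_directed_triangle G /\ rainbow_transitive_triangle G.
Proof.
have dense i : #|V| ^ 2 < 2 * num_edges (G i).
  by have := hG i; rewrite hn -(ltr_nat rat) natrM natrX; lra.
have C4 : 3 < #|'I_c| by rewrite card_ord.
by split; [apply: exists_rainbow_directed | apply: exists_rainbow_transitive].
Qed.
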